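(* Let $H\in\mathbb{R}^{n\times n}$ be a random symmetric matrix drawn from a rotation-invariant ensemble with $\mathbb{E}[H]=0$ and $$\mathbb{E}[H_{ab}H_{cd}]=\tau^2(\delta_{ac}\delta_{bd}+\delta_{ad}\delta_{bc})\qquad\text{for all }a,b,c,d\in\{1,\dots,n\},$$ where $\tau^2>0$. Then for any vectors $d_i,d_j\in\mathbb{R}^n$, the quadratic forms $q_i:=\tfrac12 d_i^\top H d_i$ and $q_j:=\tfrac12 d_j^\top H d_j$ satisfy $$\operatorname{Cov}(q_i,q_j)=\tfrac{\tau^2}{2}(d_i^\top d_j)^2=\tau^2A_{ij},$$ where $A_{ij}:=\tfrac12(d_i^\top d_j)^2$.
   Context: $\delta_{ab}$ is the Kronecker delta. Rotation-invariant means that $H$ and $U^\top HU$ have the same distribution for every orthogonal matrix $U$. *)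

(* Defs.v *)
From HB Require Import structures.
From mathcomp Require Import all_boot all_order all_algebra.
From mathcomp Require Import all_classical all_reals all_analysis.

Set Implicit Arguments.
Unset Strict Implicit.
Unset Printing Implicit Defensive.

Import Order.TTheory GRing.Theory Num.Theory.
Import numFieldNormedType.Exports.

Local Open Scope classical_set_scope.
Local Open Scope ring_scope.

(* Convertible to 'M[R]_n; the alias only carries the Borel sigma-algebra of
   the topology that MathComp-Analysis puts on matrices. *)
Notation borel_matrix R n := (g_sigma_algebraType (@open 'M[R : realType]_n)).

Definition symmetric_mx (R : realType) (n : nat) (A : 'M[R]_n) : Prop :=
  A^T = A.

Definition orthogonal_mx (R : realType) (n : nat) (U : 'M[R]_n) : Prop :=
  U^T *m U = 1%:M.

(* [distribution P X] is by definition [pushforward P X], for X bundled with a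
   proof of measurability; [pushforward] is used for U^T H U to avoid having to
   bundle that map. *)
Definition rotation_invariant (d : measure_display) (T : measurableType d)
    (R : realType) (P : probability T R) (n : nat)
    (H : {RV P >-> borel_matrix R n}) : Prop :=
  forall U : 'M[R]_n, orthogonal_mx U ->
    forall B : set (borel_matrix R n), measurable B ->
      distribution P H B =
      pushforward P (fun t => U^T *m H t *m U : borel_matrix R n) B.

Definition dotv (R : realType) (n : nat) (u v : 'cV[R]_n) : R :=
  (u^T *m v) 0 0.

Definition quad_form (R : realType) (n : nat) (v : 'cV[R]_n) (A : 'M[R]_n) : R :=
  (v^T *m A *m v) 0 0.

(* Main.v *)
(** Finite second moments put every entry of H in L^2, so all products of two
entries are integrable and Cov(q_i, q_j) = E[q_i q_j] expands, by linearity,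
into the second moments of the entries. Each of the two Kronecker pairings then
contributes tau^2 (d_i . d_j)^2 / 4. *)

Require Import Defs.
From mathcomp Require Import all_boot all_order all_algebra.
From mathcomp Require Import all_classical all_reals all_analysis.
From mathcomp Require Import measurable_realfun ring.

Import Order.TTheory GRing.Theory Num.Theory.
Import numFieldNormedType.Exports.

Local Open Scope classical_set_scope.
Local Open Scope ring_scope.

(** Coordinates are continuous, so open intervals pull back to open sets, and open intervals
    generate the Borel sets of [R]. *)
Lemma measurable_borel_matrix_coord (R : realType) (n : nat) (a b : 'I_n) :
  measurable_fun [set: borel_matrix R n] (fun A : borel_matrix R n => A a b).
Proof.
apply: (measurability (@RGenOpens.G R)); first exact: RGenOpens.measurableE.
move=> _ [_ [x [y ->]] <-]; rewrite setTI; apply: sub_sigma_algebra.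
have /continuousP := @coord_continuous R n n a b.
by apply; exact: interval_open.
Qed.

Lemma quad_formE (R : realType) (n : nat) (v : 'cV[R]_n) (A : 'M[R]_n) :
  quad_form v A = \sum_(p : 'I_n * 'I_n) v p.1 0 * v p.2 0 * A p.1 p.2.
Proof.
rewrite /quad_form mxE -(pair_bigA _ (fun a b => v a 0 * v b 0 * A a b)) /=.
rewrite exchange_big /=; apply: eq_bigr => b _; rewrite mxE mulr_suml.
by apply: eq_bigr => a _; rewrite mxE mulrAC.
Qed.

Lemma dotvE (R : realType) (n : nat) (u v : 'cV[R]_n) :
  dotv u v = \sum_a u a 0 * v a 0.
Proof. by rewrite /dotv mxE; apply: eq_bigr => a _; rewrite mxE. Qed.

Section lfun_expectation.
Context {d : measure_display} {T : measurableType d} {R : realType}.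
Variable P : probability T R.

(** The L^2 norm is a power of the integral of [|f|^2], which agrees with [|f^2|]; this turns a
    finite second moment into membership in L^2. *)
Lemma integrable_sqr_Lfun2 (f : T -> R) :
  measurable_fun setT f -> P.-integrable setT (EFin \o (fun t => f t ^+ 2)) ->
  f \in Lfun P 2%:E.
Proof.
move=> mf /integrableP[_ foo]; rewrite inE; apply/andP; split; rewrite inE //=.
rewrite /finite_norm unlock /Lnorm poweR_lty //.
apply: le_lt_trans foo; rewrite le_eqVlt; apply/orP; left; apply/eqP.
apply: eq_integral => t _ /=.
by rewrite powR_mulrn// -normrX.
Qed.

Lemma Lfun1_lincomb (I : finType) (c : I -> R) (X : I -> T -> R) :
  (forall i, X i \in Lfun P 1) ->
  (fun t => \sum_i c i * X i t) \in Lfun P 1.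
Proof.
move=> X1; rewrite (_ : (fun _ => _) = \sum_i (c i \o* X i)).
  by rewrite rpred_sum// => i _; exact: Lfun_scale.
apply/funext => t; rewrite fct_sumE; apply: eq_bigr => i _ /=.
by rewrite mulrC.
Qed.

Lemma expectation_lincomb (I : finType) (c : I -> R) (X : I -> T -> R) :
  (forall i, X i \in Lfun P 1) ->
  'E_P[fun t => (\sum_i c i * X i t)%R]%E = (\sum_i (c i)%:E * 'E_P[X i])%E.
Proof.
(* [expectation_sum] runs over a list of functions, so the sum over [I] is first recast as one over
   such a list. *)
move=> X1; rewrite (_ : (fun _ => _) = \sum_(f <- [seq c i \o* X i | i : I]) f).
  rewrite expectation_sum.
    by rewrite big_image /=; apply: eq_bigr => i _; rewrite expectationZl.
  by move=> f /mapP[i _ ->]; exact: Lfun_scale.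
apply/funext => t; rewrite big_image fct_sumE; apply: eq_bigr => i _ /=.
by rewrite mulrC.
Qed.

End lfun_expectation.

(** Each Kronecker pairing forces the second index pair to be the first one, either in order or
    swapped. Both cases leave the double sum of [u_a v_a u_b v_b], which is the square of the dot
    product. *)
Lemma isserlis_sum (R : realType) (n : nat) (u v : 'cV[R]_n) :
  \sum_(p : ('I_n * 'I_n) * ('I_n * 'I_n))
    (u p.1.1 0 * u p.1.2 0) * (v p.2.1 0 * v p.2.2 0) *
    ((p.1.1 == p.2.1)%:R * (p.1.2 == p.2.2)%:R +
     (p.1.1 == p.2.2)%:R * (p.1.2 == p.2.1)%:R) = 2 * dotv u v ^+ 2.
Proof.
have inner a b : \sum_(q : 'I_n * 'I_n) (u a 0 * u b 0) * (v q.1 0 * v q.2 0) *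
    ((a == q.1)%:R * (b == q.2)%:R + (a == q.2)%:R * (b == q.1)%:R) =
    2 * ((u a 0 * v a 0) * (u b 0 * v b 0)).
  (* Only the index [(x, y)] survives. The swapped pairing is the instance [pick b a], which gives
     the same product by commutativity. *)
  have pick (x y : 'I_n) : \sum_(q : 'I_n * 'I_n) (v q.1 0 * v q.2 0) *
      ((x == q.1)%:R * (y == q.2)%:R) = v x 0 * v y 0.
    rewrite (bigD1 (x, y)) //= !eqxx !mulr1 big1 ?addr0 // => -[c e] /=.
    rewrite xpair_eqE negb_and [c == x]eq_sym [e == y]eq_sym.
    by case: eqP => //= _; [case: eqP => //= _ _|move=> _]; rewrite !(mulr0, mul0r).
  transitivity (\sum_(q : 'I_n * 'I_n) (u a 0 * u b 0 *
      (v q.1 0 * v q.2 0 * ((a == q.1)%:R * (b == q.2)%:R)) + u a 0 * u b 0 *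
      (v q.1 0 * v q.2 0 * ((b == q.1)%:R * (a == q.2)%:R)))).
    by apply: eq_bigr => q _; ring.
  by rewrite big_split /= -!mulr_sumr !pick; ring.
rewrite -(pair_bigA _ (fun p q => (u p.1 0 * u p.2 0) * (v q.1 0 * v q.2 0) *
    ((p.1 == q.1)%:R * (p.2 == q.2)%:R + (p.1 == q.2)%:R * (p.2 == q.1)%:R))) /=.
under eq_bigr => p _ do rewrite inner.
rewrite -mulr_sumr; congr (_ * _).
rewrite -(pair_bigA _ (fun a b => u a 0 * v a 0 * (u b 0 * v b 0))) /=.
rewrite expr2 dotvE mulr_suml; apply: eq_bigr => a _.
by rewrite mulr_sumr.
Qed.

Theorem proposition3p9 (d : measure_display) (T : measurableType d)
    (R : realType) (P : probability T R) (n : nat)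
    (H : {RV P >-> borel_matrix R n}) (tau : R) :
  0 < tau ^+ 2 ->
  (forall t : T, symmetric_mx (H t)) ->
  rotation_invariant H ->
  (forall a b : 'I_n, 'E_P[fun t : T => H t a b]%E = 0%:E) ->
  (forall a b c e : 'I_n,
     'E_P[fun t : T => (H t a b * H t c e)%R]%E =
     (tau ^+ 2 * ((a == c)%:R * (b == e)%:R + (a == e)%:R * (b == c)%:R))%:E) ->
  forall di dj : 'cV[R]_n,
    let qi : T -> R := fun t => 2^-1 * quad_form di (H t) in
    let qj : T -> R := fun t => 2^-1 * quad_form dj (H t) in
    let Aij : R := 2^-1 * dotv di dj ^+ 2 in
    covariance P qi qj = (tau ^+ 2 / 2 * dotv di dj ^+ 2)%:E /\
    covariance P qi qj = (tau ^+ 2 * Aij)%:E.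
Proof.
move=> _ _ _ mean0 cov di dj qi qj Aij.
have mH a b : measurable_fun setT (fun t => H t a b).
  by apply: (measurableT_comp (measurable_borel_matrix_coord R n a b)); exact: measurable_funP.
have H2 a b : (fun t => H t a b) \in Lfun P 2%:E.
  apply: integrable_sqr_Lfun2 => //; apply/integrableP; split.
    by apply/measurable_EFinP; exact: measurable_funX.
  under eq_integral => t _ do rewrite /= ger0_norm ?sqr_ge0// expr2.
  (* The integrand is nonnegative, so integrability only asks for a finite integral, and the
     second-moment hypothesis at equal index pairs gives a real value. *)
  by have := cov a b a b; rewrite unlock => ->; rewrite ltry.
have H1 a b : (fun t => H t a b) \in Lfun P 1.
  by apply: Lfun_subset12; rewrite ?H2// fin_num_measure.
have HH1 a b c e : (fun t => H t a b * H t c e) \in Lfun P 1.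
  exact: (Lfun2_mul_Lfun1 (H2 a b) (H2 c e)).
(* The factor 1/2 is absorbed in the weights, making each quadratic form a plain linear combination
   of entries of [H]. *)
pose k (u : 'cV[R]_n) (p : 'I_n * 'I_n) := 2^-1 * (u p.1 0 * u p.2 0).
have qE u : (fun t => 2^-1 * quad_form u (H t)) =
    (fun t => \sum_p k u p * H t p.1 p.2).
  apply/funext => t; rewrite quad_formE mulr_sumr.
  by apply: eq_bigr => p _; rewrite mulrA.
have q1 u : (fun t => 2^-1 * quad_form u (H t)) \in Lfun P 1.
  by rewrite qE; apply: Lfun1_lincomb => p; exact: H1.
have Eq u : 'E_P[fun t => (2^-1 * quad_form u (H t))%R]%E = 0%E.
  rewrite qE expectation_lincomb; last by move=> p; exact: H1.
  by rewrite big1// => p _; rewrite mean0 mule0.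
(* Indexing by pairs of pairs makes the product a single linear combination too, so the same two
   lemmas on linear combinations apply to it. *)
have qqE : qi * qj = (fun t => \sum_(p : ('I_n * 'I_n) * ('I_n * 'I_n))
    (k di p.1 * k dj p.2) * (H t p.1.1 p.1.2 * H t p.2.1 p.2.2)).
  rewrite /qi /qj !qE; apply/funext => t.
  rewrite /GRing.mul/= mulr_suml.
  rewrite -(pair_bigA _ (fun p q => (k di p * k dj q) *
    (H t p.1 p.2 * H t q.1 q.2))) /=.
  apply: eq_bigr => p _; rewrite mulr_sumr; apply: eq_bigr => q _.
  by rewrite mulrACA.
have covE : covariance P qi qj = (tau ^+ 2 / 2 * dotv di dj ^+ 2)%:E.
  rewrite covarianceE ?q1//; last first.
    by rewrite qqE; apply: Lfun1_lincomb => p; exact: HH1.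
  rewrite !Eq mule0 sube0 qqE expectation_lincomb; last by move=> p; exact: HH1.
  under eq_bigr => p _ do rewrite cov -EFinM.
  rewrite sumEFin; congr EFin.
  (* The 4 collects the two factors 1/2 hidden in [k]; the 2 counts the two pairings. *)
  transitivity (tau ^+ 2 / 4 * (2 * dotv di dj ^+ 2)); last by field.
  rewrite -isserlis_sum mulr_sumr; apply: eq_bigr => p _.
  by rewrite /k; field.
by split; rewrite covE // /Aij -mulrA.
Qed.
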